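(* Let $n\ge1$ be an integer. Let $B$ be a finitely related group and let $A$ be the subgroup of $B$ generated by $\mathcal{A}=\{a_i\mid i\in\mathcal{I}\}\subset B$; let $m$ denote the number of elements of $\mathcal{A}$. Suppose that $\mathcal{A}$ is linearly independent in $H_1(B;\mathbb{Q})$ and that $H_2(B;\mathbb{Q})=\langle\Phi^{(n-1)}(B)\rangle$. Then $A/A^{(n)}$ is the free solvable group of derived length $n$ on $\mathcal{A}$; that is, if $F$ is the free group on $\mathcal{A}$, then the map $F\to A$ induces an isomorphism $F/F^{(n)}\cong A/A^{(n)}$. In particular, $A$ maps onto the free solvable group on $\mathcal{A}$ of derived length $n$, and hence is not nilpotent if $m>1$. Moreover, $A/A^{(n)}$ embeds in $B/B^{(n)}$.
   Context: A group is finitely related if it admits a presentation with finitely many relators (possibly infinitely many generators). $G^{(n)}$ is the derived series: $G^{(0)}=G$, $G^{(n+1)}=[G^{(n)},G^{(n)}]$. $\Phi^{(k)}(B)$ is the image of the inclusion-induced map $H_2(B^{(k)};\mathbb{Z})\to H_2(B;\mathbb{Z})$, and $\langle\Phi^{(k)}(B)\rangle$ is the $\mathbb{Q}$-subspace of $H_2(B;\mathbb{Q})$ spanned by its image. ''$\mathcal{A}$ is linearly independent in $H_1(B;\mathbb{Q})$'' means that the family of images of the $a_i$ ($i\in\mathcal{I}$) is linearly independent over $\mathbb{Q}$.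
   Formalization: The clause ''hence is not nilpotent if m>1'' is stated only for n≥2, since it fails for n=1: B=A=Z^2 with the standard basis satisfies all hypotheses with m=2, but A is abelian. *)

(* Defs.v *)
From HB Require Import structures.
From mathcomp.multinomials Require Import monalg.
From mathcomp Require Import finmap.
From mathcomp Require Import all_boot all_order all_algebra.
From mathcomp Require Import boolp classical_sets functions cardinality.

Set Implicit Arguments.
Unset Strict Implicit.
Unset Printing Implicit Defensive.

Import GRing.Theory.

Local Open Scope classical_set_scope.

Reserved Notation "{ 'ghom' G -> H }" (at level 0, G at level 98, H at level 99,
  format "{ 'ghom'  G  ->  H }").
Notation "{ 'ghom' G -> H }" :=
  (UMagmaMorphism.type G%type H%type) : type_scope.

HB.mixin Record isConjClosed (G : groupType) (S : {pred G}) := {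
  gpredJr : forall x g : G, x \in S -> (x ^ g)%g \in S
}.

#[short(type="normalClosed")]
HB.structure Definition NormalClosed (G : groupType) :=
  {S of isConjClosed G S & GroupClosed G S}.

Local Open Scope group_scope.

Definition subgroup (G : groupType) (S : groupClosed G) := {x : G | x \in S}.

Section SubgroupGroup.
Variables (G : groupType) (S : groupClosed G).

HB.instance Definition _ := SubChoice.on (subgroup S).

Lemma groupClosed_group_closed : group_closed [in S].
Proof. by split=> [|x y xS yS]; [exact: (@gpred1 _ S) | exact: (@gpredF _ S)]. Qed.

HB.instance Definition _ :=
  SubChoice_isSubGroup.Build G [in S] (subgroup S) groupClosed_group_closed.

End SubgroupGroup.

Section Preimage.
Variables (G H : groupType) (f : {ghom G -> H}) (S : groupClosed H).

Definition gpreim : {pred G} := [pred x | f x \in S].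

Lemma gpreimM : mulg_closed gpreim.
Proof. by move=> x y; rewrite !inE gmulfM => ? ?; rewrite gpredM. Qed.
Lemma gpreim1 : 1 \in gpreim.
Proof. by rewrite inE gmulf1 gpred1. Qed.
Lemma gpreimV : invg_closed gpreim.
Proof. by move=> x; rewrite !inE gmulfV gpredV. Qed.

HB.instance Definition _ := isMulClosed.Build G gpreim gpreimM.
HB.instance Definition _ := isMul1Closed.Build G gpreim gpreim1.
HB.instance Definition _ := isInvClosed.Build G gpreim gpreimV.

End Preimage.

Section Conjugation.
Variables (G : groupType) (g : G).
Definition conj_by (x : G) := x ^ g.
Lemma conj_by_morphism : monoid.monoid_morphism conj_by.
Proof. by split=> [|x y]; [exact: conj1g | exact: conjMg]. Qed.
HB.instance Definition _ :=
  isUMagmaMorphism.Build G G conj_by conj_by_morphism.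
End Conjugation.

Section Generated.
Variable G : groupType.
Implicit Types A : set G.

Definition generated A : {pred G} :=
  [pred x | `[< forall H : groupClosed G, A `<=` [set` H] -> x \in H >]].

Lemma mem_generated A x : A x -> x \in generated A.
Proof. by move=> Ax; apply/asboolP => H; apply. Qed.

Lemma generated_min A (H : groupClosed G) :
  A `<=` [set` H] -> {subset generated A <= H}.
Proof. by move=> AH x /asboolP; apply. Qed.

Lemma generatedM A : mulg_closed (generated A).
Proof.
move=> x y /asboolP xA /asboolP yA; apply/asboolP => H AH.
by rewrite gpredM ?xA ?yA.
Qed.
Lemma generated1 A : 1 \in generated A.
Proof. by apply/asboolP => H _; rewrite gpred1. Qed.
Lemma generatedV A : invg_closed (generated A).
Proof. by move=> x /asboolP xA; apply/asboolP => H AH; rewrite gpredV xA. Qed.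

HB.instance Definition _ A :=
  isMulClosed.Build G (generated A) (@generatedM A).
HB.instance Definition _ A :=
  isMul1Closed.Build G (generated A) (@generated1 A).
HB.instance Definition _ A :=
  isInvClosed.Build G (generated A) (@generatedV A).

Definition generator_in A (x : set_type A) : subgroup (generated A) :=
  Sub (val x) (mem_generated (set_valP x)).

Lemma generated_conj A : (forall x g, A x -> A (x ^ g)) ->
  forall x g, x \in generated A -> x ^ g \in generated A.
Proof.
move=> AJ x g; apply: (@generated_min A (gpreim (conj_by g) (generated A))).
by move=> y Ay; apply: mem_generated; exact: AJ.
Qed.

Definition normal_closure A : {pred G} :=
  generated [set r ^ g | r in A & g in [set: G]].

HB.instance Definition _ A := GroupClosed.on (normal_closure A).

Lemma normal_closureJ A x g :
  x \in normal_closure A -> x ^ g \in normal_closure A.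
Proof.
apply: generated_conj => _ h [r Ar [k _ <-]].
by exists r => //; exists (k * h) => //; rewrite conjgM.
Qed.

HB.instance Definition _ A :=
  isConjClosed.Build G (normal_closure A) (@normal_closureJ A).

End Generated.

Lemma generated_morph (G H : groupType) (f : {ghom G -> H}) (A : set G)
    (S : groupClosed H) :
  (forall x, A x -> f x \in S) -> forall x, x \in generated A -> f x \in S.
Proof. by move=> fA; apply: (@generated_min _ A (gpreim f S)). Qed.

Section Quotient.
Variables (G : groupType) (N : normalClosed G).

Definition lcoset_equiv (x y : G) := x^-1 * y \in N.

Lemma lcoset_equiv_class : equiv_class_of lcoset_equiv.
Proof.
split=> [x|x y|y x z]; rewrite /lcoset_equiv ?mulVg ?gpred1 //.
  by rewrite -gpredV invgM invgK.
by move=> xy yz; rewrite -[x^-1](mulgK y) -mulgA gpredM.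
Qed.

Canonical lcoset_equiv_equiv := EquivRelPack lcoset_equiv_class.
Canonical lcoset_equiv_enc := defaultEncModRel lcoset_equiv.

Definition quotg := {eq_quot lcoset_equiv}%qT.
HB.instance Definition _ : EqQuotient G lcoset_equiv quotg :=
  EqQuotient.on quotg.
HB.instance Definition _ := Choice.on quotg.

Local Open Scope quotient_scope.

Lemma quotgP (x y : G) : \pi_quotg x = \pi_quotg y <-> x^-1 * y \in N.
Proof. by split=> [/eqP|?]; [|apply/eqP]; rewrite piE. Qed.

Lemma reprgK (x : quotg) : \pi_quotg (repr x) = x.
Proof. exact: reprK. Qed.

Lemma pi_reprg (x : G) : x^-1 * repr (\pi_quotg x) \in N.
Proof. by apply/quotgP; rewrite reprK. Qed.

Definition quotg_one : quotg := \pi_quotg 1.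
Definition quotg_mul (x y : quotg) : quotg := \pi_quotg (repr x * repr y).
Definition quotg_inv (x : quotg) : quotg := \pi_quotg (repr x)^-1.

Lemma pi_mulg x y : \pi_quotg (x * y) = quotg_mul (\pi_quotg x) (\pi_quotg y).
Proof.
apply/quotgP; set x' := repr _; set y' := repr _.
have -> : (x * y)^-1 * (x' * y') = (x^-1 * x') ^ y * (y^-1 * y').
  by rewrite conjgE invgM !mulgA mulgK.
by rewrite gpredM ?pi_reprg ?gpredJr ?pi_reprg.
Qed.

Lemma pi_invg x : \pi_quotg x^-1 = quotg_inv (\pi_quotg x).
Proof.
apply/quotgP; set x' := repr _; rewrite invgK.
have -> : x * x'^-1 = (x'^-1 * x) ^ x'^-1.
  by rewrite conjgE invgK mulgA mulVKg.
by rewrite gpredJr // -gpredV invgM invgK pi_reprg.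
Qed.

Lemma quotg_mulA : associative quotg_mul.
Proof.
by move=> x y z; rewrite -[x]reprgK -[y]reprgK -[z]reprgK -!pi_mulg mulgA.
Qed.
Lemma quotg_mul1 : left_id quotg_one quotg_mul.
Proof. by move=> x; rewrite -[x]reprgK -pi_mulg mul1g. Qed.
Lemma quotg_mulr1 : right_id quotg_one quotg_mul.
Proof. by move=> x; rewrite -[x]reprgK -pi_mulg mulg1. Qed.
Lemma quotg_mulV : left_inverse quotg_one quotg_inv quotg_mul.
Proof. by move=> x; rewrite -[x]reprgK -pi_invg -pi_mulg mulVg. Qed.
Lemma quotg_mulrV : right_inverse quotg_one quotg_inv quotg_mul.
Proof. by move=> x; rewrite -[x]reprgK -pi_invg -pi_mulg mulgV. Qed.

HB.instance Definition _ := isGroup.Build quotg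
  quotg_mulA quotg_mul1 quotg_mulr1 quotg_mulV quotg_mulrV.

Definition quotg_pi (x : G) : quotg := \pi_quotg x.

Lemma quotg_pi_morphism : monoid.monoid_morphism quotg_pi.
Proof. by split=> // x y; exact: pi_mulg. Qed.
HB.instance Definition _ :=
  isUMagmaMorphism.Build G quotg quotg_pi quotg_pi_morphism.

End Quotient.

Section Series.
Variable G : groupType.

Fixpoint derived (n : nat) : {pred G} :=
  if n is n'.+1
  then generated [set [~ x, y] | x in [set` derived n'] & y in [set` derived n']]
  else predT.

Fixpoint lower_central (n : nat) : {pred G} :=
  if n is n'.+1
  then generated [set [~ x, y] | x in [set` lower_central n'] & y in [set: G]]
  else predT.

Definition nilpotent_group := exists c, forall x, x \in lower_central c -> x = 1.

Lemma derivedM n : mulg_closed (derived n).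
Proof. by case: n => [|n] //=; exact: generatedM. Qed.
Lemma derived1 n : 1 \in derived n.
Proof. by case: n => [|n] //=; exact: generated1. Qed.
Lemma derivedV n : invg_closed (derived n).
Proof. by case: n => [|n] //=; exact: generatedV. Qed.
Lemma derivedJ n x g : x \in derived n -> x ^ g \in derived n.
Proof.
elim: n x g => [|n IHn] //= x g.
apply: generated_conj => _ h [y y_n [z z_n <-]].
by exists (y ^ h); [exact: IHn | exists (z ^ h); [exact: IHn | rewrite conjRg]].
Qed.

HB.instance Definition _ n :=
  isMulClosed.Build G (derived n) (@derivedM n).
HB.instance Definition _ n :=
  isMul1Closed.Build G (derived n) (derived1 n).
HB.instance Definition _ n :=
  isInvClosed.Build G (derived n) (@derivedV n).
HB.instance Definition _ n :=
  isConjClosed.Build G (derived n) (@derivedJ n).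

End Series.

Arguments derived : clear implicits.
Arguments lower_central : clear implicits.
Arguments nilpotent_group : clear implicits.

Section DerivedQuotient.

Definition derived_quot (G : groupType) (n : nat) := quotg (derived G n).
HB.instance Definition _ G n := Group.on (derived_quot G n).

Variables (G H : groupType) (n : nat) (f : {ghom G -> H}).

Lemma derived_morph k x : x \in derived G k -> f x \in derived H k.
Proof.
elim: k x => [|k IHk] //= x; apply: generated_morph => _ [y yk [z zk <-]].
rewrite gmulfR; apply: mem_generated.
by exists (f y); [exact: IHk | exists (f z); first exact: IHk].
Qed.

(* Independent of the representative: see derived_quot_mapE. *)
Definition derived_quot_map (x : derived_quot G n) : derived_quot H n :=
  quotg_pi (derived H n) (f (repr x)).

Lemma derived_quot_mapE x : derived_quot_map (quotg_pi (derived G n) x) =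
  quotg_pi (derived H n) (f x).
Proof.
apply/esym/quotgP; rewrite -gmulfV -gmulfM derived_morph //.
exact: (@pi_reprg G (derived G n)).
Qed.

Lemma derived_quot_map_morphism : monoid.monoid_morphism derived_quot_map.
Proof.
have piM := @gmulfM _ _ (quotg_pi (derived G n)).
have piK (z : derived_quot G n) : z = quotg_pi (derived G n) (repr z).
  exact/esym/reprgK.
split=> [|x y].
  by rewrite [1 in LHS](esym (@gmulf1 _ _ (quotg_pi (derived G n))))
             derived_quot_mapE !gmulf1.
rewrite (piK x) (piK y) -[X in derived_quot_map X]piM !derived_quot_mapE.
by rewrite !gmulfM.
Qed.

HB.instance Definition _ := isUMagmaMorphism.Build
  (derived_quot G n) (derived_quot H n) derived_quot_map
  derived_quot_map_morphism.

End DerivedQuotient.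

Arguments derived_quot_map {G H} n f x.

Local Close Scope group_scope.

Section FreeGroup.
Local Open Scope group_scope.
Variable X : choiceType.

(* The elements of the free group on X are the reduced words; the letter
   (x, true) stands for the inverse of x. *)
Definition letter := (X * bool)%type.
Implicit Types (l : letter) (u v w : seq letter).

Definition letter_inv l : letter := (l.1, ~~ l.2).

Definition reduced : pred (seq letter) :=
  sorted (fun l l' => l' != letter_inv l).

Record free_group := FreeGroup {word :> seq letter; _ : reduced word}.

HB.instance Definition _ := [isSub for word].
HB.instance Definition _ := [Choice of free_group by <:].

Definition cons_red l w :=
  if w is l' :: w' then if l' == letter_inv l then w' else l :: w else [:: l].

Lemma letter_invK : involutive letter_inv.
Proof. by case=> x b; rewrite /letter_inv /= negbK. Qed.

Lemma cons_red_reduced l w : reduced w -> reduced (cons_red l w).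
Proof.
case: w => [|l' w] //= red_w; case: ifP => [_|/negbT l'l /=].
  exact: path_sorted red_w.
by rewrite l'l.
Qed.

Lemma cons_redE l w : reduced (l :: w) -> cons_red l w = l :: w.
Proof. by case: w => [|l' w] //= /andP[/negPf-> _]. Qed.

Lemma cons_redK l w : reduced w -> cons_red l (cons_red (letter_inv l) w) = w.
Proof.
case: w => [|l' w] red_w /=; first by rewrite eqxx.
rewrite letter_invK; case: eqP => [l'l|_] /=; last by rewrite eqxx.
by rewrite cons_redE -?l'l.
Qed.

Definition mul_word u v := foldr cons_red v u.

Lemma mul_word_reduced u v : reduced v -> reduced (mul_word u v).
Proof. by move=> rv; elim: u => //= l u; exact: cons_red_reduced. Qed.

Lemma mul_cons_red l u v : reduced v ->
  mul_word (cons_red l u) v = cons_red l (mul_word u v).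
Proof.
case: u => [|l' u] //= rv; case: eqP => [->|//].
by rewrite cons_redK // mul_word_reduced.
Qed.

Lemma mul_wordA u v w : reduced w ->
  mul_word u (mul_word v w) = mul_word (mul_word u v) w.
Proof. by move=> rw; elim: u => //= l u ->; rewrite mul_cons_red. Qed.

Definition inv_word u := rev (map letter_inv u).

Lemma inv_word_reduced u : reduced u -> reduced (inv_word u).
Proof.
rewrite /reduced /inv_word rev_sorted sorted_map; apply: sub_sorted.
move=> l l' /=; apply: contraNneq => /(can_inj letter_invK)->.
by rewrite letter_invK.
Qed.

Lemma mul_inv_word u : mul_word (inv_word u) u = [::].
Proof.
rewrite /mul_word /inv_word; elim: u => //= l u IHu.
by rewrite rev_cons foldr_rcons /= letter_invK eqxx.
Qed.

Lemma word_reduced (u : free_group) : reduced u. Proof. by case: u. Qed.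

Definition fg_one := @FreeGroup [::] isT.
Definition fg_mul (u v : free_group) :=
  FreeGroup (mul_word_reduced u (word_reduced v)).
Definition fg_inv (u : free_group) :=
  FreeGroup (inv_word_reduced (word_reduced u)).

Lemma fg_mulA : associative fg_mul.
Proof. by move=> u v w; apply/val_inj/mul_wordA/word_reduced. Qed.
Lemma fg_mul1 : left_id fg_one fg_mul.
Proof. by move=> u; apply/val_inj. Qed.
Lemma fg_mulr1 : right_id fg_one fg_mul.
Proof.
move=> [u ru]; apply/val_inj; rewrite /= /mul_word.
elim: u ru => //= l u IHu ru.
by rewrite IHu ?cons_redE //; exact: path_sorted ru.
Qed.
Lemma fg_mulV : left_inverse fg_one fg_inv fg_mul.
Proof. by move=> u; apply/val_inj/mul_inv_word. Qed.
Lemma fg_mulrV : right_inverse fg_one fg_inv fg_mul.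
Proof.
move=> u; rewrite -{1}[u](_ : fg_inv (fg_inv u) = u) ?fg_mulV //.
apply/val_inj; rewrite /= /inv_word map_rev revK mapK //.
exact: letter_invK.
Qed.

HB.instance Definition _ := isGroup.Build free_group
  fg_mulA fg_mul1 fg_mulr1 fg_mulV fg_mulrV.

Definition fg_gen (x : X) : free_group := @FreeGroup [:: (x, false)] isT.

Section Lift.
Variables (G : groupType) (f : X -> G).

Definition letter_val l : G := if l.2 then (f l.1)^-1 else f l.1.

Definition fg_lift (u : free_group) : G := \prod_(l <- word u) letter_val l.

Lemma letter_valV l : letter_val (letter_inv l) = (letter_val l)^-1.
Proof. by case: l => x []; rewrite /letter_val /= ?invgK. Qed.

Lemma prod_mul_word u v : \prod_(l <- mul_word u v) letter_val l =
  (\prod_(l <- u) letter_val l) * (\prod_(l <- v) letter_val l).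
Proof.
elim: u => [|l u IHu]; first by rewrite big_nil mul1g.
rewrite big_cons -mulgA -{}IHu /=; case: (mul_word u v) => [|l' w] /=.
  by rewrite big_cons big_nil.
case: eqP => [->|_]; rewrite !big_cons //.
by rewrite letter_valV mulVKg.
Qed.

Lemma fg_lift_morphism : monoid.monoid_morphism fg_lift.
Proof. by split=> [|u v]; [exact: big_nil | exact: prod_mul_word]. Qed.

HB.instance Definition _ :=
  isUMagmaMorphism.Build free_group G fg_lift fg_lift_morphism.

Lemma fg_lift_gen x : fg_lift (fg_gen x) = f x.
Proof. by rewrite /fg_lift /= big_seq1. Qed.

Lemma fg_lift_unique (h : {ghom free_group -> G}) :
  (forall x, h (fg_gen x) = f x) -> h =1 fg_lift.
Proof.
move=> hf [u ru]; elim: u ru => [|l u IHu] ru.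
  rewrite [FreeGroup _](_ : _ = 1) ?gmulf1 //; exact/val_inj.
have ru' := path_sorted ru.
pose g := fg_gen l.1; pose gl := if l.2 then g^-1 else g.
have -> : FreeGroup ru = gl * FreeGroup ru'.
  apply/val_inj; rewrite /= -[LHS]cons_redE // /gl /g.
  by case: (l) => x [].
rewrite !gmulfM IHu /gl; congr (_ * _).
by case: ifP; rewrite ?gmulfV /g hf /= fg_lift_gen.
Qed.

End Lift.
End FreeGroup.

Definition free_solvable (X : choiceType) (n : nat) :=
  derived_quot (free_group X) n.
HB.instance Definition _ X n := Group.on (free_solvable X n).

Definition finitely_related (G : groupType) := exists (X : choiceType)
  (rels : seq (free_group X))
  (f : {ghom quotg (normal_closure [set` rels]) -> G}), bijective f.

Section Modules.
Local Open Scope ring_scope.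
Local Open Scope quotient_scope.

Section LmodQuotient.
Variables (R : nzRingType) (V : lmodType R) (W : submodClosed V).

(* GRing.submodClosed lives on semimodules, so closure under opposites has to
   be derived to use Quotient.quot. *)
Definition submod_pred : {pred V} := W.

Lemma submod_zmod_closed : zmod_closed submod_pred.
Proof.
split=> [|x y]; first exact: (@rpred0 _ W).
move=> Wx Wy; rewrite -scaleN1r.
by apply: (@rpredD _ W) => //; apply: (@rpredZ _ _ W).
Qed.
HB.instance Definition _ :=
  GRing.isZmodClosed.Build V submod_pred submod_zmod_closed.

Definition lquot := @Quotient.quot V submod_pred.
HB.instance Definition _ := GRing.Zmodule.on lquot.

Definition lquot_pi (x : V) : lquot := \pi_(@Quotient.quot V submod_pred) x.
Definition lquot_repr (x : lquot) : V := repr x.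

Lemma lquot_reprK : cancel lquot_repr lquot_pi.
Proof. exact: reprK. Qed.

Lemma lquotP (x y : V) : lquot_pi x = lquot_pi y <-> x - y \in W.
Proof.
rewrite /lquot_pi -[_ \in W]/(_ \in submod_pred) Quotient.idealrBE.
by split=> /eqP.
Qed.

Lemma lquot_piD : {morph lquot_pi : x y / x + y}.
Proof. by move=> x y; rewrite /lquot_pi raddfD. Qed.

Definition lquot_scale (a : R) (x : lquot) : lquot :=
  lquot_pi (a *: lquot_repr x).

Lemma lquot_piZ a x : lquot_pi (a *: x) = lquot_scale a (lquot_pi x).
Proof.
apply/lquotP; rewrite -scalerBr.
by apply: (@rpredZ _ _ W); apply/lquotP; rewrite lquot_reprK.
Qed.

Lemma lquot_scaleA a b (v : lquot) :
  lquot_scale a (lquot_scale b v) = lquot_scale (a * b) v.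
Proof. by rewrite -[v]lquot_reprK -!lquot_piZ scalerA. Qed.
Lemma lquot_scale1 : left_id 1 lquot_scale.
Proof. by move=> v; rewrite -[v]lquot_reprK -lquot_piZ scale1r. Qed.
Lemma lquot_scaleDr : right_distributive lquot_scale +%R.
Proof.
move=> a u v; rewrite -[u]lquot_reprK -[v]lquot_reprK.
by rewrite -lquot_piD -!lquot_piZ scalerDr lquot_piD.
Qed.
Lemma lquot_scaleDl v : {morph lquot_scale^~ v : a b / a + b}.
Proof.
by move=> a b; rewrite -[v]lquot_reprK -!lquot_piZ scalerDl lquot_piD.
Qed.

HB.instance Definition _ := GRing.Zmodule_isLmodule.Build R lquot
  lquot_scaleA lquot_scale1 lquot_scaleDr lquot_scaleDl.

Lemma lquot_pi_linear : linear lquot_pi.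
Proof. by move=> a x y; rewrite lquot_piD lquot_piZ. Qed.
HB.instance Definition _ := GRing.isLinear.Build R V lquot _ lquot_pi
  lquot_pi_linear.

End LmodQuotient.

Section Homology.
Variables (R : nzRingType) (C D E : lmodType R).
Variables (d : {linear C -> D}) (e : {linear D -> E}).

Definition cycle_pred : {pred D} := [pred z | e z == 0].

Lemma cycle_submod : submod_closed cycle_pred.
Proof.
split=> [|a x y]; rewrite !inE ?linear0 // => /eqP ex /eqP ey.
by rewrite linearP ex ey scaler0 addr0.
Qed.
HB.instance Definition _ :=
  GRing.isSubmodClosed.Build R D cycle_pred cycle_submod.

Definition cycles := {z : D | z \in cycle_pred}.
HB.instance Definition _ := SubChoice.on cycles.
HB.instance Definition _ := [SubChoice_isSubLmodule of cycles by <:].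

Definition boundary_pred : {pred cycles} :=
  [pred z | `[< exists c, d c = val z >]].

Lemma boundary_submod : submod_closed boundary_pred.
Proof.
split=> [|a x y]; first by apply/asboolP; exists 0; rewrite linear0.
move=> /asboolP[c dc] /asboolP[c' dc']; apply/asboolP; exists (a *: c + c').
by rewrite linearP dc dc' linearP.
Qed.
HB.instance Definition _ :=
  GRing.isSubmodClosed.Build R cycles boundary_pred boundary_submod.

(* The composite of d and e is not required to vanish here: the quotient is by
   the boundaries that are cycles. *)
Definition homology := lquot boundary_pred.
HB.instance Definition _ := GRing.Lmodule.on homology.

Definition homology_class (z : cycles) : homology := lquot_pi boundary_pred z.
HB.instance Definition _ := GRing.Linear.copy homology_class
  (lquot_pi boundary_pred).

Lemma homology_classP (z z' : cycles) :
  homology_class z = homology_class z' <-> exists c, d c = val z - val z'.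
Proof.
by rewrite lquotP; split=> [/asboolP|?]; [|apply/asboolP].
Qed.

End Homology.

Definition lin_span (R : nzRingType) (V : lmodType R) (S : set V) : set V :=
  [set v | exists2 s : seq (R * V), (forall p, p \in s -> S p.2) &
             v = \sum_(p <- s) p.1 *: p.2].

Definition lin_indep (R : nzRingType) (V : lmodType R) (I : Type) (v : I -> V) :=
  forall (k : nat) (i : 'I_k -> I) (c : 'I_k -> R), injective i ->
    \sum_(j < k) c j *: v (i j) = 0 -> forall j, c j = 0.

End Modules.

Section FreeModules.
Local Open Scope ring_scope.

Lemma msum_extend (R : nzRingType) (K : choiceType) (V : zmodType)
    (g : K -> R -> V) (g0 : forall k, g k 0 = 0)
    (c : {malg R[K]}) (D : {fset K}) : (msupp c `<=` D)%fset ->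
  \sum_(k <- msupp c) g k c@_k = \sum_(k <- D) g k c@_k.
Proof.
move=> cD; apply: big_fset_incl => // k _ kc.
by rewrite mcoeff_outdom.
Qed.

Lemma monalgU_scale (R : nzRingType) (K : choiceType) (x : R) (k : K) :
  << x *g k >> = x *: << k >> :> {malg R[K]}.
Proof.
by apply/malgP => k'; rewrite mcoeffZ !mcoeffU mulrnAr mulr1.
Qed.

Lemma malg_additive_ext (R : nzRingType) (K : choiceType) (V : zmodType)
    (f g : {additive {malg R[K]} -> V}) :
  (forall x k, f << x *g k >> = g << x *g k >>) -> f =1 g.
Proof.
by move=> fg c; rewrite [c]monalgE (raddf_sum f) (raddf_sum g); apply: eq_bigr.
Qed.

Section LinearExtension.
Variables (R : nzRingType) (K : choiceType) (V : lmodType R) (h : K -> V).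

Definition malg_lin (c : {malg R[K]}) : V := \sum_(k <- msupp c) c@_k *: h k.

Lemma malg_lin_linear : linear malg_lin.
Proof.
move=> a c c'; pose D := (msupp c `|` msupp c' `|` msupp (a *: c + c'))%fset.
have g0 k : (0 : R) *: h k = 0 by rewrite scale0r.
rewrite /malg_lin !(@msum_extend _ _ _ (fun k x => x *: h k) g0 _ D);
  do ?[by apply/fsubsetP => k kc; rewrite !inE kc ?orbT].
rewrite scaler_sumr -big_split /=; apply: eq_bigr => k _.
by rewrite mcoeffD mcoeffZ scalerDl scalerA.
Qed.
HB.instance Definition _ :=
  GRing.isLinear.Build R {malg R[K]} V _ malg_lin malg_lin_linear.

Lemma malg_linU x k : malg_lin << x *g k >> = x *: h k.
Proof.
rewrite /malg_lin (@msum_extend _ _ _ (fun k x => x *: h k) _ _ [fset k]%fset).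
- by rewrite big_seq_fset1 mcoeffUU.
- by move=> ?; rewrite scale0r.
- exact: msuppU_le.
Qed.

End LinearExtension.

Section PushForward.
Variables (R S : nzRingType) (s : {rmorphism R -> S}).
Variables (K L : choiceType) (h : K -> L).

Definition malg_push (c : {malg R[K]}) : {malg S[L]} :=
  \sum_(k <- msupp c) << s c@_k *g h k >>.

Lemma malg_push_additive : zmod_morphism malg_push.
Proof.
move=> c c'; pose D := (msupp c `|` msupp c' `|` msupp (c - c'))%fset.
have g0 k : << s 0 *g h k >> = 0 :> {malg S[L]} by rewrite rmorph0 monalgU0.
rewrite /malg_push !(@msum_extend _ _ _ (fun k x => << s x *g h k >>) g0 _ D);
  do ?[by apply/fsubsetP => k kc; rewrite !inE kc ?orbT].
rewrite -sumrB; apply: eq_bigr => k _.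
by rewrite mcoeffB rmorphB monalgUB.
Qed.
HB.instance Definition _ := GRing.isZmodMorphism.Build {malg R[K]} {malg S[L]}
  malg_push malg_push_additive.

Lemma malg_pushU x k : malg_push << x *g k >> = << s x *g h k >>.
Proof.
rewrite /malg_push
  (@msum_extend _ _ _ (fun k x => << s x *g h k >>) _ _ [fset k]%fset).
- by rewrite big_seq_fset1 mcoeffUU.
- by move=> ?; rewrite rmorph0 monalgU0.
- exact: msuppU_le.
Qed.

End PushForward.

End FreeModules.

(* Homology in degrees 1 and 2 is taken from the inhomogeneous bar complex with
   trivial coefficients in R. *)
Notation bar1 R G := {malg R[G]}.
Notation bar2 R G := {malg R[(G * G)%type]}.
Notation bar3 R G := {malg R[(G * G * G)%type]}.

Section BarComplex.
Local Open Scope ring_scope.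
Variables (R : nzRingType) (G : groupType).

(* With trivial coefficients d [g] = [] - [] = 0. *)
Definition bar_d1 : {linear bar1 R G -> R^o} := \0.

Definition bar_d2 : {linear bar2 R G -> bar1 R G} :=
  malg_lin (fun p : G * G => let: (g, h) := p in
    << h >> - << (g * h)%g >> + << g >> : bar1 R G).

Definition bar_d3 : {linear bar3 R G -> bar2 R G} :=
  malg_lin (fun p : G * G * G => let: (g, h, k) := p in
    << (h, k) >> - << ((g * h)%g, k) >> + << (g, (h * k)%g) >> - << (g, h) >>
    : bar2 R G).

Definition H1 := homology bar_d2 bar_d1.
Definition H2 := homology bar_d3 bar_d2.
HB.instance Definition _ := GRing.Lmodule.on H1.
HB.instance Definition _ := GRing.Lmodule.on H2.

Lemma bar1_cycle (c : bar1 R G) : c \in cycle_pred bar_d1.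
Proof. by rewrite inE. Qed.

Definition H1_class (g : G) : H1 :=
  homology_class bar_d2 (Sub (<< g >> : bar1 R G) (bar1_cycle _)).

Lemma bar_d2U x g h : bar_d2 << x *g (g, h) >> =
  x *: (<< h >> - << (g * h)%g >> + << g >> : bar1 R G).
Proof. exact: malg_linU. Qed.

Lemma bar_d3U x g h k : bar_d3 << x *g (g, h, k) >> =
  x *: (<< (h, k) >> - << ((g * h)%g, k) >> + << (g, (h * k)%g) >>
        - << (g, h) >> : bar2 R G).
Proof. exact: malg_linU. Qed.

Lemma bar_d2_d3 (c : bar3 R G) : bar_d2 (bar_d3 c) = 0.
Proof.
apply: (@malg_additive_ext _ _ _ (bar_d2 \o bar_d3) \0 _ c).
move=> x [[g h] k] /=; rewrite /GRing.null_fun.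
rewrite bar_d3U linearZ linearB linearD linearB /= !bar_d2U !scale1r !mulgA.
set A : bar1 R G := << k >>; set B := << (h * k)%g >>; set C := << h >>.
set D := << (g * h * k)%g >>; set F := << (g * h)%g >>; set J := << g >>.
suff -> : A - B + C - (A - D + F) + (B - D + J) - (C - F + J) = 0.
  by rewrite scaler0.
rewrite !(opprD, opprK) !addrA.
rewrite [LHS](ACl (1*4*2*7*3*10*5*8*6*11*9*12))%AC.
by rewrite /= subrr add0r addNr add0r subrr add0r subrr add0r addNr add0r subrr.
Qed.

End BarComplex.

Section Functoriality.
Local Open Scope ring_scope.
Variables (R S : nzRingType) (s : {rmorphism R -> S}).
Variables (G H : groupType) (f : {ghom G -> H}).

Definition bar1_map : bar1 R G -> bar1 S H := malg_push s f.
Definition bar2_map : bar2 R G -> bar2 S H :=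
  malg_push s (fun p : G * G => (f p.1, f p.2)).
Definition bar3_map : bar3 R G -> bar3 S H :=
  malg_push s (fun p : G * G * G => (f p.1.1, f p.1.2, f p.2)).

HB.instance Definition _ := GRing.Additive.on bar1_map.
HB.instance Definition _ := GRing.Additive.on bar2_map.
HB.instance Definition _ := GRing.Additive.on bar3_map.

Lemma bar_d2_map c : bar_d2 S H (bar2_map c) = bar1_map (bar_d2 R G c).
Proof.
apply: (@malg_additive_ext _ _ _ (bar_d2 S H \o bar2_map)
                                 (bar1_map \o bar_d2 R G)) => x [g h] /=.
rewrite bar_d2U /bar2_map malg_pushU /= bar_d2U.
rewrite !scalerDr !scalerN -!monalgU_scale !raddfD !raddfN /=.
by rewrite /bar1_map !malg_pushU gmulfM.
Qed.

Lemma bar_d3_map c : bar_d3 S H (bar3_map c) = bar2_map (bar_d3 R G c).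
Proof.
apply: (@malg_additive_ext _ _ _ (bar_d3 S H \o bar3_map)
                                 (bar2_map \o bar_d3 R G)) => x [[g h] k] /=.
rewrite bar_d3U /bar3_map malg_pushU /= bar_d3U.
rewrite !scalerDr !scalerN -!monalgU_scale !raddfD !raddfN /=.
by rewrite /bar2_map !malg_pushU /= !gmulfM.
Qed.

Lemma bar2_map_cycle (z : cycles (bar_d2 R G)) :
  bar2_map (val z) \in cycle_pred (bar_d2 S H).
Proof. by rewrite inE bar_d2_map (eqP (valP z)) raddf0. Qed.

Definition cycle2_map (z : cycles (bar_d2 R G)) : cycles (bar_d2 S H) :=
  Sub (bar2_map (val z)) (bar2_map_cycle z).

(* Independent of the representative: see H2_mapE. *)
Definition H2_map (x : H2 R G) : H2 S H :=
  homology_class _ (cycle2_map (lquot_repr x)).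

Lemma H2_mapE (z : cycles (bar_d2 R G)) :
  H2_map (homology_class _ z) = homology_class _ (cycle2_map z).
Proof.
have [c dc] : exists c, bar_d3 R G c =
    val (lquot_repr (homology_class (bar_d3 R G) z)) - val z.
  by apply/homology_classP; rewrite /homology_class lquot_reprK.
by apply/homology_classP; exists (bar3_map c); rewrite bar_d3_map dc raddfB.
Qed.

End Functoriality.

Section Phi.
Variable B : groupType.

Definition H2_rat : H2 int B -> H2 rat B := H2_map (intmul 1) idfun.

(* Phi B k is the image of H_2(B^(k); Z) in H_2(B; Z), and Phi_span B k is the
   Q-subspace of H_2(B; Q) it spans. *)
Definition Phi (k : nat) : set (H2 int B) :=
  range (H2_map idfun (val : subgroup (derived B k) -> B)).

Definition Phi_span (k : nat) : set (H2 rat B) :=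
  lin_span [set H2_rat x | x in Phi k]%classic.

End Phi.

Arguments Phi : clear implicits.
Arguments Phi_span : clear implicits.

(* Main.v *)
(* A word w of F with phi w in B^(n) is shown to lie in F^(n) by means of
   polynomial functions B -> rat (functions killed by a power of the
   augmentation ideal) that are invariant under B^(n).

   Integration: if m_a is a polynomial function invariant under B^(j), for each
   generator a, then some polynomial function f invariant under B^(j+1)
   satisfies f (t a) - f t = m_a t for all a.  This amounts to a derivation from
   B to the module of invariant polynomial functions with prescribed values at
   the generators.  It is built degree by degree: the obstruction at each stage
   is a rational 2-cocycle with trivial action that vanishes on B^(j), hence on
   the image of H_2(B^(n-1)), hence on all of H_2(B; Q), and the freedom in the
   choice of the cobounding function is fixed at the generators by their linear
   independence in H_1(B; Q).

   Detection, by induction on j: if w lies in F^(j) but not in F^(j+1), then the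
   closed path spelled by w in the Cayley graph of F / F^(j) crosses some edge
   (s, a) a nonzero net number of times.  By induction some invariant polynomial
   function vanishes at the other vertices of the path but not at s; taking it
   for m_a, and 0 for the other generators, the integral f separates phi w
   from 1. *)
Require Import Defs.
From HB Require Import structures.
From mathcomp.multinomials Require Import monalg.
From mathcomp Require Import finmap.
From mathcomp Require Import all_boot all_order all_algebra.
From mathcomp Require Import boolp classical_sets functions cardinality.
From mathcomp Require Import ring zify.

Set Implicit Arguments.
Unset Strict Implicit.
Unset Printing Implicit Defensive.

Import GRing.Theory.

Local Open Scope classical_set_scope.

(** * Generated subgroups and the derived series *)

Section GroupFacts.
Local Open Scope group_scope.

Lemma generated_ind (G : groupType) (A S : set G) :
    S 1 -> (forall x y, S x -> S y -> S (x * y)) ->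
    (forall x, S x -> S x^-1) -> A `<=` S ->
  forall x, x \in generated A -> S x.
Proof.
move=> S1 SM SV AS x /asboolP xA.
pose P : {pred G} := [pred y | `[< S y >]].
have PM : mulg_closed P.
  by move=> y z /asboolP Sy /asboolP Sz; apply/asboolP; exact: SM.
have P1 : 1 \in P by apply/asboolP.
have PV : invg_closed P by move=> y /asboolP Sy; apply/asboolP; exact: SV.
pose H : groupClosed G := HB.pack P (isMulClosed.Build G P PM)
  (isMul1Closed.Build G P P1) (isInvClosed.Build G P PV).
suff : x \in H by move=> /asboolP.
by apply: xA => y Ay; apply/asboolP; exact: AS.
Qed.

Lemma derivedS (G : groupType) n (x : G) :
  x \in derived G n.+1 -> x \in derived G n.
Proof.
apply: (@generated_min _ _ (derived G n)) => _ [y yn [z zn <-]].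
by rewrite /= commgEl gpredM ?gpredV // derivedJ.
Qed.

Lemma derived_le (G : groupType) m n (x : G) :
  (m <= n)%N -> x \in derived G n -> x \in derived G m.
Proof.
move=> /subnK <-; elim: (n - m)%N => // i IHi /derivedS; exact: IHi.
Qed.

End GroupFacts.

(** * Extension of linear maps in arbitrary dimension *)

Section LinearExtension.
Local Open Scope ring_scope.
Variables (K : fieldType) (W V : lmodType K).

Definition linear_graph (V0 : set V) (S : set (W * V)) :=
  [/\ S 0, forall k x y, S x -> S y -> S (k *: x + y),
      forall v, S (0, v) -> v = 0 & forall x, S x -> V0 x.2].

(** A maximal graph is total: otherwise a missing [w] could be sent to 0, which leaves the set of
    values unchanged. *)
Lemma linear_extension (V0 : set V) (L : set (W * V)) : linear_graph V0 L ->
  exists g : {linear W -> V},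
    (forall x, L x -> g x.1 = x.2) /\ (forall w, V0 (g w)).
Proof.
move=> goodL.
(* Ranging over the sets to be joined to [L], rather than over graphs containing [L], makes the
   union of the empty chain admissible. *)
have [|A [[S0 Slin Sfun SV0] Amax]] :=
    @Zorn_bigcup (W * V)%type [set A | linear_graph V0 (L `|` A)].
  move=> F FP Ftot.
  have FP2 x y : (L `|` \bigcup_(X in F) X) x ->
      (L `|` \bigcup_(X in F) X) y ->
    exists A, [/\ linear_graph V0 (L `|` A),
      (L `|` A `<=` L `|` \bigcup_(X in F) X),
      (L `|` A) x & (L `|` A) y].
    have sub X : F X -> (L `|` X `<=` L `|` \bigcup_(X in F) X).
      by move=> FX; apply: setUS; apply: bigcup_sup.
    move=> [Lx|[X FX Xx]] [Ly|[Y FY Yy]].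
    - exists set0; split; rewrite ?setU0 //; exact: subsetUl.
    - exists Y; split; [exact: FP|exact: sub|by left|by right].
    - exists X; split; [exact: FP|exact: sub|by right|by left].
    have [XY|YX] := Ftot _ _ FX FY.
      by exists Y; split; [exact: FP|exact: sub|right; apply: XY|right].
    by exists X; split; [exact: FP|exact: sub|right|right; apply: YX].
  case: (goodL) => L0 _ _ _; split=> [|k x y Sx Sy|v Sv|x Sx].
  - by left.
  - have [A [[_ Alin _ _] sA Ax Ay]] := FP2 _ _ Sx Sy.
    by apply: sA; apply: Alin.
  - by have [A [[_ _ Afun _] _ Av _]] := FP2 _ _ Sv Sv; apply: Afun.
  - by have [A [[_ _ _ AV0] _ Ax _]] := FP2 _ _ Sx Sx; apply: AV0.
set S := (L `|` A) in S0 Slin Sfun SV0.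
have Stot w : exists v, S (w, v).
  apply: contrapT => Sw.
  pose S' := [set x : W * V | exists k, S (x.1 + k *: w, x.2)].
  have SS' : (S `<=` S').
    by move=> [x v] Sx; exists 0; rewrite /= scale0r addr0.
  apply: (Amax S').
    split; first by apply: subset_trans SS'; exact: subsetUr.
    move=> /(_ (w, 0)) S'A; apply: Sw; exists 0; right; apply: S'A.
    by exists (-1); rewrite /= scaleN1r subrr.
  rewrite /= (setUidr (subset_trans (@subsetUl _ L A) SS')).
  split=> [|k [x v] [y u] [l /= Sx] [m /= Sy]|v [k /=]|x [k Sx]].
  - exact: SS'.
  - exists (k * l + m) => /=.
    suff -> : (k *: x + y + (k * l + m) *: w, k *: v + u)
      = k *: (x + l *: w, v) + (y + m *: w, u) by exact: Slin.
    by rewrite scalerDl -scalerA addrACA -scalerDr.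
  - rewrite add0r; have [->|k0 Skw] := eqVneq k 0.
      by rewrite scale0r; exact: Sfun.
    case: Sw; exists (k^-1 *: v).
    have := Slin k^-1 _ _ Skw S0.
    suff -> : k^-1 *: (k *: w, v) + 0 = (w, k^-1 *: v) by [].
    by rewrite addr0 -[in RHS](scale1r w) -(mulVf k0) -scalerA.
  - exact: (SV0 _ Sx).
have Suniq w v v' : S (w, v) -> S (w, v') -> v = v'.
  move=> Sv Sv'; apply/eqP; rewrite -subr_eq0; apply/eqP/Sfun.
  have := Slin (-1) _ _ Sv' Sv.
  suff -> : -1 *: (w, v') + (w, v) = (0, v - v') by [].
  by rewrite scaleN1r addrC; congr pair; rewrite subrr.
pose g w := projT1 (cid (Stot w)).
have gS w : S (w, g w) := projT2 (cid (Stot w)).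
have glin : linear g.
  by move=> k x y; apply: Suniq (gS _) (Slin k _ _ (gS x) (gS y)).
pose g' : {linear W -> V} := HB.pack g (GRing.isLinear.Build _ _ _ _ g glin).
exists g'; split=> [[w v] Lw|w]; last exact: (SV0 _ (gS w)).
by apply: Suniq (gS w) _; left.
Qed.

(** The pairs [(p u, q u)] form a graph over the image of [p], single-valued by the kernel
    condition. *)
Lemma linear_factor (U : lmodType K) (p : {linear U -> W}) (q : {linear U -> V}) :
  (forall u, p u = 0 -> q u = 0) ->
  exists g : {linear W -> V}, forall u, g (p u) = q u.
Proof.
move=> pq; pose L := [set x : W * V | exists u, x = (p u, q u)].
have [|g [gL _]] := @linear_extension setT L.
  split=> [|k _ _ [u ->] [u' ->]|v [u [/esym pu ->]]|//]; last exact: pq.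
    by exists 0; rewrite !linear0.
  by exists (k *: u + u'); rewrite !linearP.
by exists g => u; apply: (gL (p u, q u)); exists u.
Qed.

End LinearExtension.

Lemma linear_projection (K : fieldType) (V : lmodType K) (V0 : set V) :
  (V0 0 -> (forall k x y, V0 x -> V0 y -> V0 (k *: x + y)) ->
  exists g : {linear V -> V},
    (forall v, V0 v -> g v = v) /\ (forall v, V0 (g v)))%R.
Proof.
move=> V00 V0lin.
have [|g [gV0 V0g]] := @linear_extension K V V V0 [set x | x.1 = x.2 /\ V0 x.1].
  split=> [//|k [x _] [y _] [/= <- Vx] [/= <- Vy]|v [/= <-//]|[x _] [/= <-//]].
  by split=> //=; exact: V0lin.
by exists g; split=> // v Vv; apply: (gV0 (v, v)).
Qed.

(** * Rational 2-cocycles and their coboundaries *)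

Section Cocycles.
Local Open Scope ring_scope.
Variables (B : groupType) (V : lmodType rat) (c : B -> B -> V).
Hypothesis c_cocycle :
  forall u v w, c v w - c (u * v)%g w + c u (v * w)%g - c u v = 0.

Let ev : {linear bar2 rat B -> V} := malg_lin (fun p : B * B => c p.1 p.2).

Let ev_d3 b : ev (bar_d3 rat B b) = 0.
Proof.
apply: (@malg_additive_ext _ _ _ (ev \o bar_d3 rat B) \0 _ b) => x [[u v] w] /=.
rewrite bar_d3U linearZ linearB linearD linearB /= !malg_linU !scale1r /=.
by rewrite c_cocycle scaler0.
Qed.

Let ev_homologous (z z' : cycles (bar_d2 rat B)) :
  homology_class (bar_d3 rat B) z = homology_class _ z' ->
  ev (val z) = ev (val z').
Proof.
move=> /homology_classP[b db]; apply/eqP; rewrite -subr_eq0 -linearB /= -db.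
by rewrite ev_d3.
Qed.

(* Every rational 2-cycle is homologous to a combination of cycles of B^(k). *)
Lemma cocycle_on_cycles (k : nat) (z : bar2 rat B) :
  [set: H2 rat B] = Phi_span B k ->
  (forall u v, u \in derived B k -> v \in derived B k -> c u v = 0) ->
  bar_d2 rat B z = 0 -> ev z = 0.
Proof.
move=> H2B c0 dz.
have Zz : z \in cycle_pred (bar_d2 rat B) by rewrite inE dz.
pose evH (h : H2 rat B) := ev (val (lquot_repr h)).
have evHE (y : cycles (bar_d2 rat B)) :
    evH (homology_class _ y) = ev (val y).
  by apply: ev_homologous; exact: lquot_reprK.
have evHlin : linear evH.
  move=> a x y; rewrite -[x]lquot_reprK -[y]lquot_reprK.
  by rewrite -![lquot_pi _ _]/(homology_class _ _) -linearP !evHE linearP.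
have evH0 : evH 0 = 0.
  have <- : homology_class (bar_d3 rat B) (0 : cycles (bar_d2 rat B)) = 0.
    exact: linear0.
  by rewrite evHE linear0.
have evHPhi x : Phi B k x -> evH (H2_rat x) = 0.
  move=> [y _ <-]; rewrite -[y]lquot_reprK.
  rewrite -[lquot_pi _ _]/(homology_class (bar_d3 int _) _).
  rewrite /H2_rat !H2_mapE evHE /cycle2_map !SubK.
  pose h : {additive bar2 int (subgroup (derived B k)) -> V} :=
    ev \o (bar2_map (intmul 1 : int -> rat) idfun \o bar2_map idfun val).
  have h0 w : h w = 0.
    apply: (@malg_additive_ext _ _ _ h \0 _ w) => x' [u v].
    rewrite /h /= /bar2_map !malg_pushU malg_linU /= c0 ?scaler0 //; exact: valP.
  move: (lquot_repr y) => {}y; exact: (h0 (val y)).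
have [s sPhi zs] : Phi_span B k (homology_class (bar_d3 rat B) (Sub z Zz)).
  by rewrite -H2B.
have <- : evH (homology_class (bar_d3 rat B) (Sub z Zz)) = ev z.
  by rewrite evHE.
rewrite zs => {zs}; elim: s sPhi => [|[a x] s IHs] sPhi.
  by rewrite big_nil.
rewrite big_cons evHlin IHs ?addr0; last first.
  by move=> p ps; apply: sPhi; rewrite inE ps orbT.
have [y Py <-] : [set H2_rat x | x in Phi B k] x.
  by apply: (sPhi (a, x)); exact: mem_head.
by rewrite evHPhi ?scaler0.
Qed.

(** A cobounding [g] amounts to a linear map on 1-chains prescribed on boundaries and on the [b x].
    The prescription is consistent because the [b x] are independent modulo boundaries and [c]
    vanishes on 2-cycles. *)
Lemma cocycle_coboundary (k : nat) (X : choiceType) (b : X -> B) (g0 : X -> V) :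
  [set: H2 rat B] = Phi_span B k ->
  lin_indep (fun x : X => H1_class rat (b x)) ->
  (forall u v, u \in derived B k -> v \in derived B k -> c u v = 0) ->
  exists g : B -> V, (forall u v, c u v = g u + g v - g (u * v)%g) /\
    (forall x, g (b x) = g0 x).
Proof.
move=> H2B bind c0.
pose U := (bar2 rat B * {malg rat[X]})%type.
pose iota : {linear {malg rat[X]} -> bar1 rat B} :=
  malg_lin (fun x => << b x >> : bar1 rat B).
pose gX : {linear {malg rat[X]} -> V} := malg_lin g0.
(* [p] lists the chains where [g] is prescribed, [q] the values prescribed there. *)
pose p (u : U) := bar_d2 rat B u.1 + iota u.2.
pose q (u : U) := ev u.1 + gX u.2.
have plin : linear p.
  by move=> a u v; rewrite /p !linearP scalerDr addrACA.
have qlin : linear q.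
  by move=> a u v; rewrite /q !linearP scalerDr addrACA.
pose p' : {linear U -> bar1 rat B} :=
    HB.pack p (GRing.isLinear.Build _ _ _ _ p plin).
pose q' : {linear U -> V} := HB.pack q (GRing.isLinear.Build _ _ _ _ q qlin).
have [u pu|g gE] := @linear_factor _ _ _ _ p' q'.
  pose cl (y : bar1 rat B) : H1 rat B :=
    homology_class (bar_d2 rat B) (Sub y (bar1_cycle y)).
  have cllin : linear cl.
    move=> a y y'; rewrite /cl -linearP; congr homology_class; exact/val_inj.
  pose cl' : {linear bar1 rat B -> H1 rat B} :=
    HB.pack cl (GRing.isLinear.Build _ _ _ _ cl cllin).
  have clb w : cl' (bar_d2 rat B w) = 0.
    rewrite -[RHS](linear0 cl'); apply/homology_classP; exists w.
    by rewrite subr0.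
  (* In H_1 the boundary disappears, leaving a linear relation between the classes of the [b x]. *)
  have u2 : u.2 = 0.
    have : cl' (iota u.2) = 0.
      rewrite -[iota _](addKr (bar_d2 rat B u.1)) [_ + iota _]pu addr0.
      by rewrite linearN clb oppr0.
    rewrite [iota _]/(malg_lin _ _) /malg_lin.
    rewrite linear_sum big_tnth => sum0.
    have coef0 := bind _ (tnth (in_tuple (msupp u.2)))
      (fun j => u.2@_(tnth (in_tuple (msupp u.2)) j)).
    apply/malgP => x; rewrite mcoeff0.
    have [xu|xu] := boolP (x \in msupp u.2); last by rewrite mcoeff_outdom.
    have [j ->] : exists j, x = tnth (in_tuple (msupp u.2)) j by exact/tnthP.
    apply: coef0 => [|].
      exact/tuple_uniqP/fset_uniq.
    rewrite -[RHS]sum0; apply: eq_bigr => i _.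
    by rewrite linearZ.
  move: pu; rewrite /q' /p' /= /p /q u2 !linear0 !addr0 => du.
  exact: (cocycle_on_cycles H2B c0 du).
exists (fun u => g << u >>); split=> [u v|x].
  have /= := gE (<< (u, v) >>, 0).
  rewrite /p /q /= !linear0 !addr0 /= bar_d2U malg_linU !scale1r /= => <-.
  by rewrite linearD linearB /= addrC addrA.
have /= := gE (0, << x >>).
by rewrite /p /q /= !linear0 !add0r /= !malg_linU !scale1r.
Qed.

End Cocycles.

(** * Polynomial functions on [B] and invariance under B^(n) *)

Section PolynomialFunctions.
Local Open Scope ring_scope.
Variable B : groupType.
Implicit Types (f g : B -> rat^o) (u v t : B).

Definition shift u f : B -> rat^o := fun t => f (t * u)%g.

(* Polynomial functions of degree less than d, so that poly_fun 0 is {0}. *)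
Fixpoint poly_fun d f : Prop :=
  if d is d'.+1 then forall v, poly_fun d' (shift v f - f) else f = 0.

Lemma shift_linear u k f g : shift u (k *: f + g) = k *: shift u f + shift u g.
Proof. by []. Qed.

Lemma poly_fun0 d : poly_fun d 0.
Proof. by elim: d => [|d IHd] //= v. Qed.

Lemma poly_fun_linear d k f g :
  poly_fun d f -> poly_fun d g -> poly_fun d (k *: f + g).
Proof.
elim: d f g => [f g /= -> ->|d IHd f g /= fd gd v].
  by rewrite scaler0 addr0.
rewrite shift_linear opprD addrACA -scalerBr; exact: IHd.
Qed.

(** The difference along [v] of the shifted function is the shift of the difference along [v ^ u],
    to which induction applies. *)
Lemma poly_fun_shift d u f : poly_fun d f -> poly_fun d (shift u f).
Proof.
elim: d u f => [u f /= ->|d IHd u f /= fd v]; first by [].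
rewrite (_ : _ - _ = shift u (shift (v ^ u)%g f - f)); first exact: IHd.
by apply/funext => t; rewrite /shift !fctE conjgE !mulgA mulgK.
Qed.

Lemma poly_funS d f : poly_fun d f -> poly_fun d.+1 f.
Proof.
elim: d f => [f -> v|d IHd f fd v]; last exact: IHd.
exact: (poly_fun0 1 v).
Qed.

Lemma poly_fun_translate d u f :
  poly_fun d f -> poly_fun d (fun t => f (u * t)%g).
Proof.
elim: d f => [f ->//|d IHd f fd v].
rewrite (_ : _ - _ = fun t => (shift v f - f) (u * t)%g); first exact: IHd.
by apply/funext => t; rewrite /shift !fctE mulgA.
Qed.

Lemma poly_fun_const d (k : rat) : poly_fun d.+1 (fun=> k).
Proof.
elim: d => [v|d IHd]; last exact: poly_funS.
by apply/funext => t; rewrite !fctE subrr.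
Qed.

(** The Leibniz rule writes a difference of the product as a sum of two products of smaller total
    degree. *)
Lemma poly_funM d e f g : poly_fun d f -> poly_fun e g ->
  poly_fun (d + e) (fun t => f t * g t).
Proof.
have [s] := ubnP (d + e); elim: s => // s IHs in d e f g *.
case: d => [|d] ltds.
  move=> f0 _; suff -> : (fun t => f t * g t) = 0 by exact: poly_fun0.
  by apply/funext => t; rewrite f0 mul0r.
case: e => [|e] in ltds *.
  move=> _ g0; suff -> : (fun t => f t * g t) = 0 by exact: poly_fun0.
  by apply/funext => t; rewrite g0 mulr0.
move=> fd ge; rewrite addSn /= => v.
rewrite (_ : _ - _ = 1 *: (fun t => (shift v f - f) t * g t) +
   (fun t => shift v f t * (shift v g - g) t)).
  apply: poly_fun_linear.
    by apply: (IHs d e.+1) => //; exact: fd.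
  rewrite addnS -addSn; apply: (IHs d.+1 e) => //; first by rewrite addnS in ltds.
  exact: poly_fun_shift.
by apply/funext => t; rewrite scale1r /shift !fctE; ring.
Qed.

Definition derived_inv n f := forall k t, k \in derived B n -> f (t * k)%g = f t.

Definition inv_poly n d f := poly_fun d f /\ derived_inv n f.

Lemma inv_poly_linear n d k f g :
  inv_poly n d f -> inv_poly n d g -> inv_poly n d (k *: f + g).
Proof.
move=> [fd fn] [gd gn]; split; first exact: poly_fun_linear.
by move=> h t hn; rewrite !fctE fn // gn.
Qed.

Lemma inv_poly0 n d : inv_poly n d 0.
Proof. by split=> //; exact: poly_fun0. Qed.

Lemma inv_polyD n d f g :
  inv_poly n d f -> inv_poly n d g -> inv_poly n d (f + g).
Proof. by move=> fP gP; rewrite -(scale1r f); exact: inv_poly_linear. Qed.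

Lemma inv_polyB n d f g :
  inv_poly n d f -> inv_poly n d g -> inv_poly n d (f - g).
Proof.
by move=> fP gP; rewrite addrC -scaleN1r; exact: inv_poly_linear.
Qed.

Lemma inv_polyS n d f : inv_poly n d f -> inv_poly n d.+1 f.
Proof. by case=> fd fn; split=> //; exact: poly_funS. Qed.

Lemma inv_poly_le n d e f : (d <= e)%N -> inv_poly n d f -> inv_poly n e f.
Proof.
move=> /subnK <-; elim: (e - d)%N => // i IHi /IHi; exact: inv_polyS.
Qed.

Lemma inv_poly_shift n d u f : inv_poly n d f -> inv_poly n d (shift u f).
Proof.
case=> fd fn; split=> [|k t kn]; first exact: poly_fun_shift.
rewrite /shift -mulgA (conjgC k u) mulgA (fn (k ^ u)%g) //; exact: derivedJ.
Qed.

Lemma inv_poly_diff n d u f : inv_poly n d.+1 f -> inv_poly n d (shift u f - f).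
Proof.
move=> fP; split; first by case: fP => fd _; exact: fd.
by case: (inv_polyB (inv_poly_shift u fP) fP).
Qed.

(** Subtracting such a projection divides out low-degree functions linearly without leaving the
    space of functions. *)
Lemma inv_poly_projection n d : exists g : {linear (B -> rat^o) -> (B -> rat^o)},
  (forall f, inv_poly n d f -> g f = f) /\ (forall f, inv_poly n d (g f)).
Proof.
apply: linear_projection; first exact: inv_poly0.
by move=> k f g; exact: inv_poly_linear.
Qed.

(** * Integration of prescribed differences at the generators *)

Section Integration.
Variables (k n d : nat) (X : choiceType) (b : X -> B) (m : X -> B -> rat^o).
Hypothesis H2B : [set: H2 rat B] = Phi_span B k.
Hypothesis bind : lin_indep (fun x : X => H1_class rat (b x)).
Hypothesis n_le_k : (n <= k)%N.
Hypothesis mP : forall x, inv_poly n d (m x).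

(** The failure of [D] to be a derivation for the action of [B] by [shift]. *)
Let defect (D : B -> B -> rat^o) u v : B -> rat^o :=
  D u + shift u (D v) - D (u * v)%g.

Let is_derivation_mod j (D : B -> B -> rat^o) :=
  [/\ forall u, inv_poly n d (D u), forall u v, inv_poly n j (defect D u v) &
      forall x, inv_poly n j (D (b x) - m x)].

(** Modulo degree less than [j] the defect is a cocycle for the trivial action. The cobounding [g]
    is chosen to equal the present error at each generator, so subtracting it repairs the derivation
    law and the values together. *)
Let derivation_step j D : (j < d)%N -> is_derivation_mod j.+1 D ->
  exists D', is_derivation_mod j D'.
Proof.
move=> jd [DP cP Dm].
have [pi1 [pi1K pi1P]] := inv_poly_projection n j.+1.
have [pi0 [pi0K pi0P]] := inv_poly_projection n j.
(* Dividing out inv_poly n j.+1 linearly makes D exactly additive on B^(n),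
   so that the next obstruction cocycle vanishes there. *)
pose E u := D u - pi1 (D u).
have leP := inv_poly_le jd.
have EP u : inv_poly n d (E u) by apply: inv_polyB => //; exact: leP.
have EcP u v : inv_poly n j.+1 (defect E u v).
  suff -> : defect E u v = defect D u v -
      (pi1 (D u) + shift u (pi1 (D v)) - pi1 (D (u * v)%g)).
    apply: inv_polyB => //; apply: inv_polyB => //; apply: inv_polyD => //.
    exact: inv_poly_shift.
  apply/funext => t; rewrite /defect /E /shift !fctE; ring.
have shift_id f u : derived_inv n f -> u \in derived B n -> shift u f = f.
  by move=> fn un; apply/funext => t; rewrite /shift fn.
have Ec0 u v : u \in derived B n -> defect E u v = 0.
  move=> un; have : pi1 (defect D u v) = defect D u v by exact: pi1K.
  rewrite /defect !shift_id //; [|by case: (EP v)|by case: (DP v)].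
  rewrite linearB linearD /E /= => pi1D.
  transitivity (D u + D v - D (u * v)%g -
      (pi1 (D u) + pi1 (D v) - pi1 (D (u * v)%g))); last by rewrite pi1D subrr.
  by apply/funext => t; rewrite !fctE; ring.
pose cc u v := defect E u v - pi0 (defect E u v).
have cc_cocycle u v w :
    cc v w - cc (u * v)%g w + cc u (v * w)%g - cc u v = 0.
  pose h := defect E v w.
  pose a := h - defect E (u * v)%g w + defect E u (v * w)%g - defect E u v.
  (* The coboundary of the defect is, up to sign, a single difference of [h]; this lowers the
     degree, so [pi0] fixes it. *)
  have aE : a = - (shift u h - h).
    rewrite /a /h /defect; apply/funext => t.
    rewrite /shift !fctE !mulgA; ring.
  have linE p q r s : (p - pi0 p) - (q - pi0 q) + (r - pi0 r) - (s - pi0 s) =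
      (p - q + r - s) - pi0 (p - q + r - s).
    rewrite !(linearD pi0, linearN pi0) /=; apply/funext => t.
    by rewrite !fctE; ring.
  rewrite /cc linE -/h -/a.
  rewrite pi0K ?subrr // aE -sub0r; apply: inv_polyB; first exact: inv_poly0.
  exact: inv_poly_diff (EcP v w).
(* [g] takes values in arbitrary functions; [pi1] brings them into [inv_poly n j.+1], and by [cut]
   this changes neither the coboundary nor the values at the generators. *)
have cut f : inv_poly n j.+1 f -> pi1 (f - pi0 f) = f - pi0 f.
  by move=> fP; apply: pi1K; apply: inv_polyB => //; exact: inv_polyS.
have [u v uk vk|g [gc gb]] := @cocycle_coboundary B _ cc cc_cocycle k X b
    (fun x => (E (b x) - m x) - pi0 (E (b x) - m x)) H2B bind.
  by rewrite /cc Ec0 ?linear0 ?subrr //; exact: derived_le uk.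
exists (fun u => E u - pi1 (g u)); split=> [u|u v|x].
- by apply: inv_polyB => //; exact: leP.
- suff -> : defect (fun u => E u - pi1 (g u)) u v =
      pi0 (defect E u v) - (shift u (pi1 (g v)) - pi1 (g v)).
    by apply: inv_polyB => //; exact: inv_poly_diff (pi1P _).
  have gE : pi1 (g u) + pi1 (g v) - pi1 (g (u * v)%g) =
      defect E u v - pi0 (defect E u v).
    rewrite -cut // -[defect _ _ _ - _]/(cc u v) gc.
    by rewrite !(linearD pi1, linearN pi1).
  transitivity (defect E u v - (pi1 (g u) + pi1 (g v) - pi1 (g (u * v)%g))
      - (shift u (pi1 (g v)) - pi1 (g v))); last by rewrite gE subKr.
  by rewrite /defect; apply/funext => t; rewrite /shift !fctE; ring.
have yP : inv_poly n j.+1 (E (b x) - m x).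
  by rewrite /E addrAC; apply: inv_polyB.
suff -> : E (b x) - pi1 (g (b x)) - m x = pi0 (E (b x) - m x) by [].
by rewrite gb cut // addrAC subKr.
Qed.

(** Starting from the zero map, which is valid modulo degree less than [d], [d] corrections give an
    exact derivation [D]; its integral is [f u = D u 1]. *)
Lemma integration : exists f, inv_poly n.+1 d.+1 f /\
  forall x, shift (b x) f - f = m x.
Proof.
have step i j : (i + j)%N = d -> exists D, is_derivation_mod j D.
  elim: i j => [|i IHi] j ijd.
    move: ijd; rewrite add0n => ->; exists (fun=> 0); split=> [u|u v|x] //.
      exact: inv_poly0.
      rewrite (_ : defect _ u v = 0) ?inv_poly0 //; exact: inv_poly0.
    rewrite sub0r -sub0r; apply: inv_polyB => //; exact: inv_poly0.
  have [|D DP] := IHi j.+1; first by rewrite addnS -addSn.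
  by apply: (derivation_step _ DP); rewrite -ijd addSn ltnS leq_addl.
have [D [DP Dmul Dm]] := step d 0%N (addn0 d).
have DM u v t : D (u * v)%g t = D u t + D v (t * u)%g.
  have [D0 _] := Dmul u v.
  have /(congr1 (fun f => f t)) := D0; rewrite /defect /shift !fctE => /eqP.
  by rewrite subr_eq0 => /eqP.
pose f : B -> rat^o := fun u => D u 1%g.
have df v : shift v f - f = D v.
  by apply/funext => t; rewrite /shift /f !fctE DM mul1g addrAC subrr add0r.
exists f; split=> [|x]; last first.
  rewrite df; have [/= /eqP] := Dm x; rewrite subr_eq0 => /eqP //.
split=> [v|]; first by rewrite df; case: (DP v).
suff fk : forall k, k \in derived B n.+1 -> forall t, f (t * k)%g = f t.
  by move=> h t hn; exact: fk.
apply: (@generated_ind _ _ [set h | forall t, f (t * h)%g = f t])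
  => [t|u v fu fv t|u fu t|_ [u un [v vn <-]] t].
- by rewrite mulg1.
- by rewrite mulgA fv fu.
- by rewrite -(fu (t * u^-1)%g) mulgVK.
(* By invariance [D y] agrees at [s * x] and [s]. The formula is symmetric in [x] and [y], so
   elements of B^(n) may be swapped and their commutators do not affect [f]. *)
- have fM x y s : x \in derived B n -> f (s * x * y)%g = f s + D x s + D y s.
    move=> xn; have [_ Dn] := DP y.
    have /(congr1 (fun h => h (s * x)%g)) := df y.
    rewrite /shift !fctE Dn // => /eqP; rewrite subr_eq => /eqP ->.
    have /(congr1 (fun h => h s)) := df x.
    rewrite /shift !fctE => /eqP; rewrite subr_eq => /eqP ->.
    by rewrite addrC (addrC (D x s)).
  have -> : (t * [~ u, v] = t * (v * u)^-1 * u * v)%g.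
    by rewrite commgEl conjgE invgM !mulgA.
  by rewrite fM // addrAC -fM // -mulgA mulgVK.
Qed.

End Integration.
End PolynomialFunctions.

(** * Schreier rewriting and paths in Cayley graphs *)

Section CayleyPaths.
Local Open Scope group_scope.

(** The inverse of the first letter occurs later; removing the pair costs a commutator of two
    elements of G^(n) and leaves a shorter balanced word. *)
Lemma balanced_prod (G : groupType) (T : choiceType) (nu : T -> G) n
    (s : seq (letter T)) :
  (forall e, nu e \in derived G n) ->
  (forall e, count_mem (e, false) s = count_mem (e, true) s) ->
  \prod_(l <- s) letter_val nu l \in derived G n.+1.
Proof.
move=> nuP; have [k] := ubnP (size s); elim: k => // k IHk in s *.
have nulP l : letter_val nu l \in derived G n.
  by rewrite /letter_val; case: ifP => _; rewrite ?gpredV.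
have prodP (r : seq (letter T)) : \prod_(l <- r) letter_val nu l \in derived G n.
  by elim: r => [|l r IHr]; rewrite ?big_nil ?gpred1 // big_cons gpredM.
case: s => [|l s] /= lts bal; first by rewrite big_nil gpred1.
have : letter_inv l \in s.
  rewrite -has_pred1 has_count; have := bal l.1.
  case: l {lts bal} => e [] /=;
    by rewrite /letter_inv /= !xpair_eqE !eqxx /=; lia.
move=> /path.splitPr sE; case: s / sE lts bal => s1 s2 lts bal.
have IH : \prod_(l <- s1 ++ s2) letter_val nu l \in derived G n.+1.
  apply: IHk => [|e].
    by move: lts; rewrite !size_cat /= addnS => /ltnW.
  have := bal e; rewrite !count_cat /=.
  case: l {lts bal} => e' b; rewrite /letter_inv /= !xpair_eqE.
  by case: (e' == e); case: b => /=; lia.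
set P1 := \prod_(l <- s1) letter_val nu l; set v := letter_val nu l.
have -> : \prod_(l <- l :: s1 ++ letter_inv l :: s2) letter_val nu l =
    [~ v^-1, P1^-1] * \prod_(l <- s1 ++ s2) letter_val nu l.
  rewrite big_cons !big_cat big_cons letter_valV -/v -/P1.
  by rewrite commgEl conjgE !invgK !mulgA mulgVK.
rewrite gpredM //; apply: mem_generated.
exists v^-1; first by rewrite /= gpredV; exact: nulP.
by exists P1^-1; rewrite /= ?gpredV //; exact: prodP.
Qed.

Variables (X : choiceType) (n : nat).
Notation F := (free_group X).
Implicit Types (u s : F) (w : seq (letter X)) (p : letter (F * X)%type).

(** A chosen word in the coset of [u] stands for the vertex, so that functions on [F] can be
    evaluated there. *)
Definition vertex u : F := repr (quotg_pi (derived F n) u).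

Lemma vertexP u : u^-1 * vertex u \in derived F n.
Proof. exact: pi_reprg. Qed.

Lemma vertex_eq u v : u^-1 * v \in derived F n -> vertex u = vertex v.
Proof. by move=> uv; congr repr; apply/quotgP. Qed.

Lemma vertex_id u : vertex (vertex u) = vertex u.
Proof. exact/esym/vertex_eq/vertexP. Qed.

Lemma vertexM u v : vertex (vertex u * v) = vertex (u * v).
Proof.
apply/esym/vertex_eq.
rewrite (_ : _ * _ = (u^-1 * vertex u) ^ v); first exact/derivedJ/vertexP.
by rewrite conjgE invgM !mulgA.
Qed.

(* The edge (s, x) joins s to s * x in the Cayley graph of F / F^(n). *)
Fixpoint edges u w : seq (letter (F * X)%type) :=
  if w is l :: w' then
    let v := u * letter_val (@fg_gen X) l in
    (vertex (if l.2 then v else u), l.1, l.2) :: edges v w'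
  else [::].

Lemma edges_vertex u w p : p \in edges u w -> vertex p.1.1 = p.1.1.
Proof.
elim: w u => //= l w IHw u; rewrite inE => /orP[/eqP->|/IHw//].
exact: vertex_id.
Qed.

(** The Schreier generator of F^(n) attached to an edge, for the transversal [vertex]. *)
Definition edge_elt (e : F * X) : F :=
  e.1 * fg_gen e.2 * (vertex (e.1 * fg_gen e.2))^-1.

Lemma edge_eltP e : edge_elt e \in derived F n.
Proof.
rewrite /edge_elt; set u := _ * fg_gen _.
rewrite -[u * _]invgK gpredV invgM invgK.
rewrite (_ : _ * _ = (u^-1 * vertex u) ^ u^-1); first exact/derivedJ/vertexP.
by rewrite conjgE invgK mulgA mulVKg.
Qed.

(** The representatives cancel between consecutive edges, as in Schreier's rewriting process. *)
Lemma prod_edges u w : \prod_(p <- edges u w) letter_val edge_elt p =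
  vertex u * (\prod_(l <- w) letter_val (@fg_gen X) l) *
  (vertex (u * \prod_(l <- w) letter_val (@fg_gen X) l))^-1.
Proof.
elim: w u => [|l w IHw] u; first by rewrite !big_nil !mulg1 mulgV.
rewrite /= !big_cons IHw.
case: l => x [] /=; rewrite /letter_val /= /edge_elt /=.
  by rewrite vertexM mulgVK !invgM !invgK !mulgA mulgVK.
by rewrite vertexM !mulgA mulgVK.
Qed.

Lemma prod_word u : \prod_(l <- word u) letter_val (@fg_gen X) l = u.
Proof. by rewrite -[LHS](fg_lift_unique (h := idfun)). Qed.

(** If every edge were balanced, the product of Schreier generators, a conjugate of [u], would lie
    in F^(n+1) by [balanced_prod]. *)
Lemma unbalanced_edge u :
  u \in derived F n -> u \notin derived F n.+1 ->
  exists e, count_mem (e, false) (edges 1 u) != count_mem (e, true) (edges 1 u).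
Proof.
move=> un uSn; apply: contrapT => bal; move/negP: uSn; apply.
have := balanced_prod (s := edges 1 u) edge_eltP.
rewrite prod_edges prod_word mul1g -(vertex_eq (u := 1) (v := u)); last first.
  by rewrite invg1 mul1g.
move=> /(_ _)/(derivedJ (vertex 1)); rewrite conjgE !mulgA mulVg mul1g mulgVK.
by apply => e; apply/eqP; apply: contrapT => /negP ee; apply: bal; exists e.
Qed.

Local Open Scope ring_scope.

(** Increments telescope; an inverse letter crosses its edge backwards, hence the sign and the
    evaluation at the far end. *)
Lemma path_integral (f : F -> rat) (m : X -> F -> rat) u w :
  (forall v x, f (v * fg_gen x)%g = f v + m x v) ->
  (forall v x, m x (vertex v) = m x v) ->
  f (u * \prod_(l <- w) letter_val (@fg_gen X) l)%g =
  f u + \sum_(p <- edges u w) (-1) ^+ p.2 * m p.1.2 p.1.1.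
Proof.
move=> fM mv; elim: w u => [|l w IHw] u; first by rewrite !big_nil mulg1 addr0.
rewrite /= !big_cons mulgA IHw addrA; congr (_ + _).
case: l => x [] /=; rewrite /letter_val /= mv ?expr1 ?expr0;
  last by rewrite fM mul1r.
by have := fM (u * (fg_gen x)^-1)%g x; rewrite mulgVK mulN1r => ->; rewrite addrK.
Qed.

End CayleyPaths.

(** * Polynomial functions detecting words outside F^(n) *)

Section Detection.
Local Open Scope ring_scope.
Variables (B : groupType) (X : choiceType) (b : X -> B).
Let phi : {ghom free_group X -> B} := fg_lift b.

(* The functions detecting points of F / F^(n) form an algebra, hence separate
   one vertex from finitely many others simultaneously. *)
Lemma separating_poly n (s0 : free_group X) (s : seq (free_group X)) :
  (forall w : free_group X, w \notin derived _ n -> exists d f,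
     inv_poly n d f /\ f (phi w) <> f 1%g) ->
  (forall u, u \in s -> (u^-1 * s0)%g \notin derived _ n) ->
  exists d f, [/\ inv_poly n d f, f (phi s0) != 0 &
    forall u, u \in s -> f (phi u) = 0].
Proof.
move=> detect; elim: s => [|u s IHs] us0.
  exists 1%N, (fun=> 1); split=> //; split=> //; exact: poly_fun_const.
have [|d [f [fP fs0 fs]]] := IHs.
  by move=> v vs; apply: us0; rewrite inE vs orbT.
have [e [g [[ge gn] gu]]] := detect _ (us0 u (mem_head _ _)).
(* Translation turns the detection of [u^-1 * s0] into a separation of [phi s0] from [phi u]. The
   bound [e.+1] below makes room for the constant even when [e] is 0. *)
pose h : B -> rat^o := fun t => g ((phi u)^-1 * t)%g - g 1%g.
exists (e.+1 + d)%N, (fun t => h t * f t); split=> [||v].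
- have [fd fn] := fP; split=> [|k t kn]; last by rewrite /h mulgA gn // fn.
  apply: poly_funM => //.
  rewrite (_ : h = -1 *: (fun=> g 1%g) + (fun t => g ((phi u)^-1 * t)%g)).
    apply: poly_fun_linear; last exact/poly_funS/poly_fun_translate.
    exact: poly_fun_const.
  by apply/funext => t; rewrite scaleN1r addrC.
- rewrite mulf_neq0 // /h subr_eq0; apply/eqP.
  by rewrite -gmulfV -gmulfM.
- rewrite inE => /orP[/eqP->|vs]; last by rewrite fs ?mulr0.
  by rewrite /h mulVg subrr mul0r.
Qed.

Lemma detecting_poly k n (w : free_group X) :
  [set: H2 rat B] = Phi_span B k ->
  lin_indep (fun x : X => H1_class rat (b x)) ->
  (n <= k.+1)%N -> w \notin derived _ n ->
  exists d f, inv_poly n d f /\ f (phi w) <> f 1%g.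
Proof.
move=> H2B bind; elim: n w => [//|n IHn] w nk wSn.
have {}IHn u : u \notin derived _ n ->
    exists d f, inv_poly n d f /\ f (phi u) <> f 1%g.
  exact: (IHn u (ltnW nk)).
have [wn|/IHn[d [f [[fd fn] fw]]]] := boolP (w \in derived _ n); last first.
  by exists d, f; split=> //; split=> // h t /derivedS; exact: fn.
have [[s0 x0] /= e0] := unbalanced_edge wn wSn.
pose es := edges n 1%g w.
pose S := [seq u <- [seq p.1.1 | p <- es] | u != s0].
(* An unbalanced edge is crossed at least once, so its origin is a chosen representative. *)
have s0v : vertex n s0 = s0.
  have [e0es|] := boolP ((s0, x0, false) \in es).
    exact: (edges_vertex e0es).
  rewrite -has_pred1 has_count -leqNgt leqn0 => /eqP c0.
  have : (s0, x0, true) \in es.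
    by rewrite -has_pred1 has_count lt0n eq_sym -c0.
  exact: edges_vertex.
have [|d [mu [muP mus0 muS]]] := separating_poly (s0 := s0) (s := S) IHn.
  move=> u; rewrite mem_filter => /andP[us0 /mapP[p pes up]].
  apply: contra us0 => /vertex_eq; rewrite s0v up => <-.
  by rewrite (edges_vertex pes).
pose m x : B -> rat^o := if x == x0 then mu else 0.
have mP x : inv_poly n d (m x).
  by rewrite /m; case: eqP => _ //; exact: inv_poly0.
have [f [fP fm]] := integration H2B bind nk mP.
exists d.+1, f; split=> //.
have fM v x : f (phi (v * fg_gen x)%g) = f (phi v) + m x (phi v).
  rewrite gmulfM /= fg_lift_gen -(fm x) /shift !fctE; ring.
have mv v x : m x (phi (vertex n v)) = m x (phi v).
  have [_ mn] := mP x; rewrite -(mulVKg v (vertex n v)) mulgA mulgV mul1g.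
  rewrite -[vertex n v](mulVKg v) [in LHS]gmulfM mn //.
  exact/derived_morph/vertexP.
have := @path_integral X n (fun v => f (phi v)) (fun x v => m x (phi v))
  1%g (word w) fM mv.
have phi1 : phi 1%g = 1%g by exact: gmulf1.
rewrite mul1g prod_word phi1 -/es => fw.
apply/eqP; rewrite -subr_eq0 fw addrAC subrr add0r.
(* Only the edge from [s0] labelled [x0] contributes, so the integral is its net number of crossings
   times [mu (phi s0)]. *)
have mE p : p \in es -> (-1) ^+ p.2 * m p.1.2 (phi p.1.1) =
    ((p == (s0, x0, false))%:R - (p == (s0, x0, true))%:R) * mu (phi s0).
  case: p => [[s x] c] pes /=; rewrite /m !xpair_eqE.
  have [_|xx0] := eqVneq x x0; last by rewrite !andbF subrr mul0r mulr0.
  have [->|ss0] := eqVneq s s0; last first.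
    rewrite muS ?mulr0 ?subrr ?mul0r // mem_filter ss0 /=.
    by apply/mapP; exists (s, x, c).
  by case: c {pes} => /=; rewrite ?sub0r ?subr0 ?expr1 ?expr0.
rewrite (eq_big_seq _ mE) -mulr_suml mulf_neq0 // sumrB.
have cnt p (r : seq (letter (free_group X * X)%type)) :
    \sum_(q <- r) (q == p)%:R = (count_mem p r)%:R :> rat.
  by elim: r => [|q r IHr]; rewrite ?big_nil // big_cons IHr -natrD.
by rewrite !cnt subr_eq0 Num.Theory.eqr_nat.
Qed.

End Detection.

(** * A metabelian test group *)

Section DyadicGroup.
Local Open Scope ring_scope.

(* Metabelian but not nilpotent, hence a witness that free solvable groups of
   length at least 2 are not nilpotent. *)
Definition dyadic := (int * rat)%type.
HB.instance Definition _ := Choice.on dyadic.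

(** The semidirect product in which 1 in [int] acts on [rat] by doubling. *)
Definition dyadic_mul (x y : dyadic) : dyadic := (x.1 + y.1, x.2 + 2 ^ x.1 * y.2).
Definition dyadic_one : dyadic := (0, 0).
Definition dyadic_inv (x : dyadic) : dyadic := (- x.1, - (2 ^ (- x.1) * x.2)).

Let two_neq0 : (2 : rat) != 0. Proof. by []. Qed.

Lemma dyadic_mulA : associative dyadic_mul.
Proof.
move=> [i x] [j y] [k z]; rewrite /dyadic_mul /= addrA expfzDr //.
by rewrite mulrDr mulrA addrA.
Qed.
Lemma dyadic_mul1 : left_id dyadic_one dyadic_mul.
Proof. by move=> [i x]; rewrite /dyadic_mul /= !add0r expr0z mul1r. Qed.
Lemma dyadic_mulr1 : right_id dyadic_one dyadic_mul.
Proof. by move=> [i x]; rewrite /dyadic_mul /= mulr0 !addr0. Qed.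
Lemma dyadic_mulV : left_inverse dyadic_one dyadic_inv dyadic_mul.
Proof. by move=> [i x]; rewrite /dyadic_mul /= !addNr. Qed.
Lemma dyadic_mulrV : right_inverse dyadic_one dyadic_inv dyadic_mul.
Proof.
move=> [i x]; rewrite /dyadic_mul /= subrr mulrN mulrA -expfzDr // subrr.
by rewrite expr0z mul1r subrr.
Qed.

HB.instance Definition _ := isGroup.Build dyadic
  dyadic_mulA dyadic_mul1 dyadic_mulr1 dyadic_mulV dyadic_mulrV.

Lemma dyadic_commg (x y : dyadic) : [~ x, y]%g.1 = 0.
Proof. by rewrite commgEl conjgE /= addrCA addKr addNr. Qed.

Lemma dyadic_derived1 (x : dyadic) : x \in derived dyadic 1 -> x.1 = 0.
Proof.
apply: (@generated_ind _ _ [set x : dyadic | x.1 = 0]) => //=.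
- by move=> y z y0 z0; rewrite /= y0 z0.
- by move=> y y0; rewrite /= y0.
by move=> _ [y _ [z _ <-]]; exact: dyadic_commg.
Qed.

Lemma dyadic_derived2 (x : dyadic) : x \in derived dyadic 2 -> x = 1%g.
Proof.
apply: (@generated_ind _ _ [set 1%g]) => [//|y z -> ->|y ->|];
  rewrite ?mulg1 ?invg1 //.
move=> _ [[i y] /dyadic_derived1/= -> [[j z] /dyadic_derived1/= -> <-]].
rewrite commgEl conjgE; congr pair => /=.
by rewrite !(oppr0, expr0z, mul1r); ring.
Qed.

Lemma dyadic_commg_gen (x : rat) :
  [~ ((0, x)%R : dyadic), ((1, 0)%R : dyadic)]%g = (0, - x / 2).
Proof.
rewrite commgEl conjgE; apply: injective_projections.
  by [].
rewrite /= !(oppr0, addr0, add0r, expr0z, mul1r, mulr0, exprN1); by field.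
Qed.

End DyadicGroup.

(** * Iterated commutators in free groups *)

Section FreeSolvable.
Local Open Scope group_scope.

Fixpoint iter_comm (G : groupType) (x y : G) c : G :=
  if c is c'.+1 then [~ iter_comm x y c', y] else x.

Lemma iter_comm_lower_central (G : groupType) (x y : G) c :
  iter_comm x y c \in lower_central G c.
Proof.
elim: c => [//|c IHc]; apply: mem_generated.
by exists (iter_comm x y c) => //; exists y.
Qed.

Lemma iter_comm_morph (G H : groupType) (f : {ghom G -> H}) (x y : G) c :
  f (iter_comm x y c) = iter_comm (f x) (f y) c.
Proof. by elim: c => //= c IHc; rewrite gmulfR IHc. Qed.

(** In [dyadic], whose second derived subgroup is trivial, each commutation with the image [(1, 0)]
    of [y] multiplies the rational coordinate by -1/2, so it never vanishes. *)
Lemma iter_comm_free (X : choiceType) (x y : X) c n : x != y -> (1 < n)%N ->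
  iter_comm (fg_gen x) (fg_gen y) c \notin derived (free_group X) n.
Proof.
move=> xy n1; apply/negP => /(derived_le n1).
pose h z : dyadic := if z == x then (0, 1)%R else (1, 0)%R.
pose hF : {ghom free_group X -> dyadic} := fg_lift h.
move=> /(derived_morph hF)/dyadic_derived2; rewrite iter_comm_morph /=.
rewrite !fg_lift_gen /h eqxx eq_sym (negPf xy).
suff [q q0 ->] : exists2 q : rat, q != 0%R &
    iter_comm ((0, 1)%R : dyadic) ((1, 0)%R : dyadic) c = (0%R, q).
  by move=> [q0']; rewrite q0' eqxx in q0.
elim: c => [|c [q q0 IHc]]; first by exists 1%R.
exists (- q / 2)%R; first by rewrite mulf_neq0 ?oppr_eq0.
by rewrite /= IHc dyadic_commg_gen.
Qed.

End FreeSolvable.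

(** * Maps between derived quotients, and the conclusion *)

Lemma derived_quot_map_pi (G H : groupType) n (f : {ghom G -> H}) u v :
  derived_quot_map n f (quotg_pi (derived G n) u) =
    derived_quot_map n f (quotg_pi (derived G n) v) <->
  f (u^-1 * v)%g \in derived H n.
Proof.
rewrite !derived_quot_mapE gmulfM gmulfV; exact: quotgP.
Qed.

Lemma derived_quot_map_inj (G H : groupType) n (f : {ghom G -> H}) :
  (forall u, f u \in derived H n -> u \in derived G n) ->
  injective (derived_quot_map n f).
Proof.
move=> fn x y; rewrite -[x]reprgK -[y]reprgK => /derived_quot_map_pi/fn uv.
exact/quotgP.
Qed.

Theorem proposition4p1 (n : nat) (B : groupType) (I : Type) (a : I -> B) :
  (1 <= n)%N ->
  finitely_related B ->
  lin_indep (fun i : I => H1_class rat (a i)) ->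
  [set: H2 rat B]%classic = Phi_span B n.-1 ->
  let calA : set B := range a in
  let A := subgroup (generated calA) in
  [/\ bijective (derived_quot_map n
        (fg_lift (@generator_in B calA) : {ghom free_group calA -> A})),
      exists f : {ghom A -> free_solvable calA n}, forall y, exists x, f x = y,
      (1 < n)%N -> (`I_2 #<= calA)%card -> ~ nilpotent_group A &
      injective (derived_quot_map n (val : {ghom A -> B}))].
Proof.
move=> n_gt0 _ aind H2B calA A.
pose F := free_group calA.
pose phi : {ghom F -> A} := fg_lift (@generator_in B calA).
pose b (x : calA) : B := val x.
(* Independence passes from the index type to the set of values by choosing an index for each
   element. *)
have bind : lin_indep (fun x : calA => H1_class rat (b x)).
  move=> k i c iinj.
  have ai x : exists j, a j = b x by have [j _ ax] := set_valP x; exists j.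
  pose ix x := projT1 (cid (ai x)).
  have ixE x : a (ix x) = b x := projT2 (cid (ai x)).
  move=> sum0; apply: (aind k (ix \o i)) => [j j' /(congr1 a)|].
    by rewrite /= !ixE => /val_inj/iinj.
  by rewrite -[RHS]sum0; apply: eq_bigr => j _; rewrite /= ixE.
have val_phi w : val (phi w) = fg_lift b w.
  rewrite -(@fg_lift_unique _ _ b (val \o phi)) // => x.
  by rewrite /= fg_lift_gen.
(* A word outside F^(n) would be separated from 1 by a function invariant under B^(n). Injectivity
   of both quotient maps and non-nilpotency rest on this. *)
have phi_derived w : val (phi w) \in derived B n -> w \in derived F n.
  move=> wB; apply: contrapT => /negP wF.
  have [|d [f [[_ fn]]]] := detecting_poly H2B bind (n := n) _ wF.
    by rewrite prednK.
  apply; transitivity (f (val (phi w))); first by rewrite val_phi.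
  by rewrite -[val (phi w)]mul1g fn.
have phi_surj x : exists w, phi w = x.
  suff [w wx] : exists w, val (phi w) = val x by exists w; exact/val_inj.
  move: (valP x); apply: (@generated_ind _ _ [set y | exists w, val (phi w) = y]).
  - by exists 1%g; rewrite !gmulf1.
  - by move=> _ _ [u <-] [v <-]; exists (u * v)%g; rewrite !gmulfM.
  - by move=> _ [u <-]; exists (u^-1)%g; rewrite !gmulfV.
  - move=> y Ay; exists (fg_gen (SigSub (mem_set Ay) : calA)).
    by rewrite val_phi fg_lift_gen.
have phi_inj : injective (derived_quot_map n phi).
  apply: derived_quot_map_inj => u un; apply: phi_derived.
  exact: (derived_morph (val : {ghom A -> B})).
have phi_onto y : exists x, derived_quot_map n phi x = y.
  have [w wy] := phi_surj (repr y); exists (quotg_pi _ w).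
  by rewrite derived_quot_mapE wy; exact: reprgK.
pose inv y := projT1 (cid (phi_onto y)).
have phiK y : derived_quot_map n phi (inv y) = y := projT2 (cid (phi_onto y)).
have invK x : inv (derived_quot_map n phi x) = x by apply: phi_inj; rewrite phiK.
split.
- by exists inv.
- pose g x : free_solvable calA n := inv (quotg_pi (derived A n) x).
  have gM : monoid.monoid_morphism g.
    split=> [|x y]; apply: phi_inj; rewrite phiK ?gmulf1 //.
    rewrite [RHS]gmulfM.
    apply: etrans (congr2 (fun y z => y * z)%g (esym (phiK _)) (esym (phiK _))).
    exact: gmulfM.
  pose g' : {ghom A -> free_solvable calA n} :=
    HB.pack g (isUMagmaMorphism.Build A (free_solvable calA n) g gM).
  exists g' => y; have [w wy] := phi_surj (phi (repr y)); exists (phi (repr y)).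
  rewrite /= /g -derived_quot_mapE invK; exact: reprgK.
- move=> n_gt1 A2 [c Ac].
  have [x [y xy]] : exists x y : calA, x != y.
    move: A2 => /card_leP[f].
    pose i2 k (kP : `I_2 k) : `I_2 := SigSub (mem_set kP).
    exists (f (i2 0%N isT)), (f (i2 1%N isT)); apply/eqP.
    by move=> /inj; rewrite !in_setT => /(_ isT isT)/(congr1 val).
  (* Nilpotency would make [phi] kill this commutator, placing it in F^(n). *)
  have := iter_comm_free c xy n_gt1; apply/negP/negPn/phi_derived.
  rewrite iter_comm_morph (Ac _ (iter_comm_lower_central _ _ c)) gmulf1.
  exact: derived1.
- apply: derived_quot_map_inj => x; have [w <-] := phi_surj x.
  by move=> /phi_derived; exact: derived_morph.
Qed.
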